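(* Suppose that every hypothesis $f\in\mathcal F$ has the form $f(x)=\arg\max_{y\in\mathcal Y}\theta(x,y)$ with $\theta\in\Theta$, where $\theta$ is linear with respect to its parameters, and that the loss $\ell$ is convex with respect to $\theta\in\Theta$. Then the optimization problem $$\min_{f\in\mathcal F,\ \gamma\in\Delta_c^n} R_n(f)\quad\text{subject to}\quad \max_{k\ne j}\theta(x_i,k)-\theta(x_i,j)\le-\gamma_{ij}\ \ \forall i,j,\qquad \max_{g\in\mathcal G}E_{\phi,n}(\gamma,g)\le\eta$$ (in the variables $\theta$, i.e. its parameter, and $\gamma$) is a convex optimization problem.
   Context: $\mathcal X=\mathcal V\times\mathcal W$ is the input domain, with $v_i\in\mathcal V$ the ''viewpoint'' component of $x_i$; $\mathcal Y=\{1,\dots,c\}$ is the set of labels; $(x_1,y_1),\dots,(x_n,y_n)\in\mathcal X\times\mathcal Y$ are given samples. The linearity assumption on $\theta$ means $\theta(x,y)=\langle\Phi(x,y),w\rangle_{\mathcal H_0}$ for a fixed feature map $\Phi:\mathcal X\times\mathcal Y\to\mathcal H_0$ into a Hilbert space $\mathcal H_0$ and a parameter $w\in\mathcal H_0$. The empirical risk is $R_n(f)=\frac1n\sum_{i=1}^n\ell(y_i,f(x_i))$; the loss of $f$ is regarded as a function of $\theta$, and the convexity hypothesis on $\ell$ is with respect to $\theta$. $\eta\ge0$. $\Delta_c=\{x\in\mathbb R^c: x_k\ge0\ \forall k,\ \sum_{k=1}^c x_k=1\}$ and $\gamma=(\gamma_{ij})\in\Delta_c^n$ means each row $(\gamma_{i1},\dots,\gamma_{ic})$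 lies in $\Delta_c$. $\mathcal G$ is a set of functions $g:\mathcal V\times\mathcal Y\to\mathbb R$ in a reproducing kernel Hilbert space $\mathcal H$, $a_n>0$ is a constant, $\phi:\mathbb R^+\to\mathbb R$ is convex and lower semicontinuous with $\phi(1)=0$, $\phi^*(v)=\sup_u(uv-\phi(u))$, and $$E_{\phi,n}(\gamma,g)=\frac1{n(n-1)}\sum_{1\le i\ne j\le n}\sum_{k=1}^c\gamma_{ik}g(v_j,k)-\frac1n\sum_{i=1}^n\sum_{k=1}^c\gamma_{ik}\phi^*(g(v_i,k))+\frac1{2a_n}\|g\|_{\mathcal H}^2.$$ *)

(* Defs.v *)
From HB Require Import structures.
From mathcomp Require Import all_boot all_order all_algebra.
From mathcomp Require Import all_classical all_reals all_analysis.

Set Implicit Arguments.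
Unset Strict Implicit.
Unset Printing Implicit Defensive.

Import Order.TTheory GRing.Theory Num.Theory.
Import numFieldNormedType.Exports.

Local Open Scope classical_set_scope.
Local Open Scope ring_scope.

(* The inner product is a separate argument; being a Hilbert space means that
   the complete norm of H is the one it induces. *)
Definition hilbert_space (R : realType) (H : completeNormedModType R)
    (dot : {dot H for idfun}) : Prop :=
  forall u : H, `|u| ^+ 2 = dot u u.

(* The elements of H are functions on T through the embedding [ev]. *)
Definition is_rkhs (R : realType) (T : Type) (H : completeNormedModType R)
    (dot : {dot H for idfun}) (ev : {linear H -> (T -> R^o)}) : Prop :=
  [/\ hilbert_space dot, injective ev &
      exists K : T -> H, forall (h : H) (t : T), ev h t = dot h (K t)].

(* As usual, a convex function has a convex domain. *)
Definition convex_on (R : realType) (E : lmodType R) (D : set E)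
    (f : E -> R) : Prop :=
  convex_set D /\ convex_function D f.

(* Convexity of an extended real-valued function is convexity of its epigraph,
   which avoids the undefined sum of +oo and -oo. *)
Definition epigraph (R : realType) (E : lmodType R) (D : set E)
    (h : E -> \bar R) : set (E * R^o)%type :=
  [set p | D p.1 /\ (h p.1 <= (p.2 : R)%:E)%E].

Definition econvex_on (R : realType) (E : lmodType R) (D : set E)
    (h : E -> \bar R) : Prop :=
  convex_set D /\ convex_set (epigraph D h).

(* Minimize [objective z] over z in [ground] subject to [constraint i z <= 0]
   for all i. *)
Record opt_problem (R : realType) (E : lmodType R) := OptProblem {
  ground : set E ;
  objective : E -> R ;
  cindex : Type ;
  constraint : cindex -> E -> \bar R
}.

Definition convex_problem (R : realType) (E : lmodType R)
    (P : opt_problem E) : Prop :=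
  convex_on (ground P) (objective P) /\
  forall i : cindex P, econvex_on (ground P) (@constraint R E P i).

Definition feasible (R : realType) (E : lmodType R) (P : opt_problem E) :
    set E :=
  [set z | ground P z /\ forall i : cindex P, (constraint i z <= 0)%E].

Lemma convex_feasible (R : realType) (E : lmodType R) (P : opt_problem E) :
  convex_problem P -> convex_set (feasible P).
Proof.
move=> [[cD _] cC] z1 z2 t /set_mem[D1 C1] /set_mem[D2 C2].
apply/mem_set; split=> [|i].
  by apply/set_mem/cD; exact/mem_set.
have [_ cepi] := cC i.
have := cepi (z1, 0) (z2, 0) t _ _.
rewrite !inE => /(_ (conj D1 (C1 i)) (conj D2 (C2 i))) [_].
by rewrite [X in (_ <= X%:E)%E](_ : _ = 0)//= !scaler0 addr0.
Qed.

(* [phi] is given on R^+ = [0, +oo[; its values at negative reals are ignored.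
   Its conjugate may take the value +oo. *)
Definition extend_pinfty (R : realType) (phi : R -> R) (u : R) : \bar R :=
  if 0 <= u then (phi u)%:E else +oo%E.

Definition conjugate (R : realType) (phi : R -> R) (v : R) : \bar R :=
  ereal_sup [set (u * v - phi u)%:E | u in [set u : R | 0 <= u]].

Definition simplex_rows (R : realType) (n c : nat) : set 'M[R]_(n, c) :=
  [set gamma | forall i, (forall k, 0 <= gamma i k) /\ \sum_k gamma i k = 1].

Section fair_classification.
Context (R : realType) (V W : Type) (n c : nat).
Context (x : 'I_n -> V * W) (y : 'I_n -> 'I_c).

Definition linear_score (H0 : completeNormedModType R)
    (dot0 : {dot H0 for idfun}) (Phi : V * W -> 'I_c -> H0) (w : H0) :
    V * W -> 'I_c -> R^o :=
  fun x0 k => dot0 (Phi x0 k) w.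

(* The loss of the hypothesis [f theta] = argmax theta at a sample sees the true
   label, the predicted label and the scores of the sample: this covers both
   losses of the predicted label and the usual surrogate losses. *)
Definition sample_loss (f : (V * W -> 'I_c -> R^o) -> V * W -> 'I_c)
    (ell : 'I_c -> 'I_c -> ('I_c -> R) -> R) (x0 : V * W) (y0 : 'I_c)
    (theta : V * W -> 'I_c -> R^o) : R :=
  ell y0 (f theta x0) (theta x0).

Definition empirical_risk (f : (V * W -> 'I_c -> R^o) -> V * W -> 'I_c)
    (ell : 'I_c -> 'I_c -> ('I_c -> R) -> R)
    (theta : V * W -> 'I_c -> R^o) : R :=
  n%:R^-1 * \sum_(i < n) sample_loss f ell (x i) (y i) theta.

(* max_(k <> j) theta(x_i, k) - theta(x_i, j) + gamma_ij, the maximum over the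
   empty set (c = 1) being -oo. *)
Definition margin_constraint (theta : V * W -> 'I_c -> R^o)
    (gamma : 'M[R]_(n, c)) (i : 'I_n) (j : 'I_c) : \bar R :=
  (\big[maxe/-oo]_(k < c | k != j) (theta (x i) k : R)%:E
    - (theta (x i) j : R)%:E + (gamma i j)%:E)%E.

(* In the second sum, 0 * +oo = 0. *)
Definition E_phi_n (H : completeNormedModType R)
    (ev : {linear H -> (V * 'I_c -> R^o)}) (a : R) (phi : R -> R)
    (gamma : 'M[R]_(n, c)) (g : H) : \bar R :=
  (((n * (n - 1))%N%:R^-1 *
      \sum_(i < n) \sum_(j < n | i != j) \sum_(k < c)
        gamma i k * ev g ((x j).1, k))%R%:E
   - (n%:R^-1)%:E * \sum_(i < n) \sum_(k < c)
        (gamma i k)%:E * conjugate phi (ev g ((x i).1, k))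
   + (`|g| ^+ 2 / (2 * a))%R%:E)%E.

(* The variables are z = (w, gamma), with theta = <Phi, w>. *)
Definition fair_problem
    (H0 : completeNormedModType R) (dot0 : {dot H0 for idfun})
    (Phi : V * W -> 'I_c -> H0) (Theta : set (V * W -> 'I_c -> R^o))
    (f : (V * W -> 'I_c -> R^o) -> V * W -> 'I_c)
    (F : set (V * W -> 'I_c)) (ell : 'I_c -> 'I_c -> ('I_c -> R) -> R)
    (H : completeNormedModType R) (ev : {linear H -> (V * 'I_c -> R^o)})
    (G : set H) (a : R) (phi : R -> R) (eta : R) :
    opt_problem (H0 * 'M[R]_(n, c))%type :=
  let theta := linear_score dot0 Phi in
  {| ground := [set z | [/\ Theta (theta z.1), F (f (theta z.1)) &
                            simplex_rows z.2]] ;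
     objective := fun z => empirical_risk f ell (theta z.1) ;
     cindex := ('I_n * 'I_c) + unit ;
     constraint := fun s z =>
       match s with
       | inl (i, j) => margin_constraint (theta z.1) z.2 i j
       | inr _ => (ereal_sup [set E_phi_n ev a phi z.2 g | g in G]
                     - eta%:E)%E
       end |}.

End fair_classification.

(* Main.v *)
(* The score is linear in the parameter w, so the ground set and the objective
   inherit convexity from the loss, and each margin constraint is a maximum of
   affine functions of (w, gamma). For a fixed g, E_phi_n is affine in gamma
   where it is finite; since phi^* never takes the value -oo, an infinite
   phi^* can only send it to -oo, on all interior points of a segment as soon as
   on one endpoint, which keeps the epigraph convex. The last constraint is a
   supremum of such functions. *)
Require Import Defs.
From HB Require Import structures.
From mathcomp Require Import all_boot all_order all_algebra.
From mathcomp Require Import all_classical all_reals all_analysis.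
From mathcomp Require Import ring lra.

Set Implicit Arguments.
Unset Strict Implicit.
Unset Printing Implicit Defensive.

Import Order.TTheory GRing.Theory Num.Theory.
Import numFieldNormedType.Exports.

Local Open Scope classical_set_scope.
Local Open Scope ring_scope.

(** * Calculus of convex functions, extended-valued and real *)

Lemma convex_set_comb (R : realType) (E : lmodType R) (A : set E) :
  convex_set A <->
  forall (t : {i01 R}) (u v : E), A u -> A v ->
    A (t%:num *: u + (1 - t%:num) *: v).
Proof.
split=> [cA t u v Au Av|cA u v t /set_mem Au /set_mem Av].
  by apply/set_mem/(cA u v t); exact/mem_set.
by apply/mem_set; exact: cA.
Qed.

(** Testing convexity through real heights [r] and [s] of the epigraph keeps [+oo] out and leaves
    [-oo] without a case of its own. *)
Lemma econvex_on_comb (R : realType) (E : lmodType R) (D : set E)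
    (h : E -> \bar R) :
  convex_set D ->
  (forall (t : {i01 R}) (u v : E) (r s : R), D u -> D v ->
    (h u <= r%:E)%E -> (h v <= s%:E)%E ->
    (h (t%:num *: u + (1 - t%:num) *: v)%R
       <= (t%:num * r + (1 - t%:num) * s)%R%:E)%E) ->
  econvex_on D h.
Proof.
move=> cD ch; split=> //; apply/convex_set_comb => t [u r] [v s] [Du hu] [Dv hv].
split; first by have /convex_set_comb := cD; apply.
exact: ch.
Qed.

Lemma econvex_on_combE (R : realType) (E : lmodType R) (D : set E)
    (h : E -> \bar R) (t : {i01 R}) (u v : E) (r s : R) :
  econvex_on D h -> D u -> D v -> (h u <= r%:E)%E -> (h v <= s%:E)%E ->
  (h (t%:num *: u + (1 - t%:num) *: v)%R
     <= (t%:num * r + (1 - t%:num) * s)%R%:E)%E.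
Proof.
move=> [_ /convex_set_comb cepi] Du Dv hu hv.
by have [] := cepi t (u, r) (v, s) (conj Du hu) (conj Dv hv).
Qed.

(** The epigraph of a supremum is the intersection of the epigraphs; an empty [G] gives the constant
    [-oo] and needs no special care. *)
Lemma econvex_on_ereal_sup (R : realType) (E : lmodType R) (D : set E)
    (I : Type) (G : set I) (h : I -> E -> \bar R) :
  convex_set D -> (forall g, G g -> econvex_on D (h g)) ->
  econvex_on D (fun u => ereal_sup [set h g u | g in G]).
Proof.
move=> cD ch; apply: econvex_on_comb => // t u v r s Du Dv hu hv.
apply: ge_ereal_sup => _ [g Gg <-].
have hg w q : (ereal_sup [set h g w | g in G] <= q -> h g w <= q)%E.
  by apply: le_trans; apply: ereal_sup_ubound; exists g.
by apply: econvex_on_combE (ch _ Gg) Du Dv (hg _ _ hu) (hg _ _ hv).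
Qed.

Lemma econvex_on_addr_cst (R : realType) (E : lmodType R) (D : set E)
    (h : E -> \bar R) (b : R) :
  econvex_on D h -> econvex_on D (fun u => (h u + b%:E)%E).
Proof.
move=> ch; apply: econvex_on_comb => [|t u v r s Du Dv].
  by case: ch.
rewrite -!leeBrDr// -!EFinB => hu hv.
by rewrite (le_trans (econvex_on_combE t ch Du Dv hu hv))// lee_fin; lra.
Qed.

Lemma convex_function_sum (R : realType) (E : lmodType R) (D : set E) (n : nat)
    (h : 'I_n -> E -> R) :
  (forall i, convex_function D (h i)) ->
  convex_function D (fun u => \sum_(i < n) h i u).
Proof.
move=> ch t u v Du Dv /=.
apply: (le_trans (ler_sum _ (fun i _ => ch i t u v Du Dv))).
by rewrite convRE !mulr_sumr -big_split.
Qed.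

Lemma convex_function_scale (R : realType) (E : lmodType R) (D : set E)
    (h : E -> R) (b : R) :
  0 <= b -> convex_function D h -> convex_function D (fun u => b * h u).
Proof.
move=> b0 ch t u v Du Dv /=.
rewrite (le_trans (ler_wpM2l b0 (ch t u v Du Dv)))// !convRE.
by rewrite mulrDr !(mulrCA b).
Qed.

(** * The conjugate and weighted sums of extended reals *)

Lemma conjugate_neq_ninfty (R : realType) (phi : R -> R) (v : R) :
  conjugate phi v != -oo%E.
Proof.
(* The point [u = 0] of the domain of [phi] gives the real lower bound [- phi 0]. *)
rewrite -ltNye (@lt_le_trans _ _ (0 * v - phi 0)%:E) ?ltNyr//.
by apply: ereal_sup_ubound; exists 0 => /=.
Qed.

Lemma mule_neq_ninfty (R : realType) (b : R) (e : \bar R) :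
  0 <= b -> e != -oo%E -> (b%:E * e)%E != -oo%E.
Proof.
case: e => [e| |]// b0 _; rewrite mulry.
by move: b0; rewrite le_eqVlt => /predU1P[<-|/gtr0_sg->];
  rewrite ?sgr0 ?mul0e ?mul1e.
Qed.

(* Unlike the multiplication by a fixed nonnegative scalar, which is additive
   only away from [+oo - oo], [b |-> b * e] is additive in the nonnegative
   weight [b] for every [e], thanks to [0 * +oo = 0]. *)
Lemma weighted_sumeD (R : realType) (I : finType) (b d : I -> R)
    (e : I -> \bar R) :
  (forall i, 0 <= b i) -> (forall i, 0 <= d i) ->
  (\sum_i (b i + d i)%R%:E * e i =
   \sum_i (b i)%:E * e i + \sum_i (d i)%:E * e i)%E.
Proof.
move=> b0 d0; rewrite -big_split/=; apply: eq_bigr => i _.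
by rewrite EFinD ge0_muleDl ?lee_fin.
Qed.

(** Since no term is [-oo], the sum never meets [+oo - oo], so a real factor [s] of either sign
    distributes over it. *)
Lemma weighted_sumeZ (R : realType) (I : finType) (b : I -> R)
    (e : I -> \bar R) (s : R) :
  (forall i, 0 <= b i) -> (forall i, e i != -oo%E) ->
  (\sum_i (s * b i)%R%:E * e i = s%:E * \sum_i (b i)%:E * e i)%E.
Proof.
move=> b0 e0; rewrite fin_num_sume_distrr//; last first.
  by move=> i j _ _; rewrite ltninfty_adde_def// inE/= ltNye mule_neq_ninfty.
by apply: eq_bigr => i _; rewrite EFinM muleA.
Qed.

Lemma weighted_sume_comb (R : realType) (I : finType) (b d : I -> R)
    (e : I -> \bar R) (s t : R) :
  0 <= s -> 0 <= t -> (forall i, 0 <= b i) -> (forall i, 0 <= d i) ->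
  (forall i, e i != -oo%E) ->
  (\sum_i (s * b i + t * d i)%R%:E * e i =
   s%:E * (\sum_i (b i)%:E * e i) + t%:E * (\sum_i (d i)%:E * e i))%E.
Proof.
move=> s0 t0 b0 d0 e0; rewrite weighted_sumeD ?weighted_sumeZ//.
  by move=> i; rewrite mulr_ge0.
by move=> i; rewrite mulr_ge0.
Qed.

(** This holds for infinite [e] too: both sides are true at [+oo] and false at [-oo]. *)
Lemma leeBl_EFin (R : realType) (b r : R) (e : \bar R) :
  (b%:E - e <= r%:E)%E = ((b - r)%:E <= e)%E.
Proof.
case: e => [e| |]; first by rewrite -EFinB !lee_fin lerBlDr lerBlDl addrC.
- by rewrite leNye leey.
- by rewrite /= leNgt ltry leeNy_eq.
Qed.

(** * Convexity of the constraints and of the problem *)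

Lemma econvex_on_comp (R : realType) (E E' : lmodType R) (D : set E)
    (D' : set E') (L : {linear E' -> E}) (h : E -> \bar R) :
  econvex_on D h -> convex_set D' -> D' `<=` L @^-1` D ->
  econvex_on D' (h \o L).
Proof.
move=> ch cD' DD'; apply: econvex_on_comb => // t u v r s D'u D'v /= hu hv.
by rewrite linearD !linearZ; apply: econvex_on_combE ch _ _ hu hv; exact: DD'.
Qed.

Lemma convex_simplex_rows (R : realType) (n c : nat) :
  convex_set (@simplex_rows R n c).
Proof.
apply/convex_set_comb => t b d hb hd i; have [b0 b1] := hb i.
have [d0 d1] := hd i; split=> [k|].
  by rewrite !mxE addr_ge0// mulr_ge0// subr_ge0.
under eq_bigr do rewrite !mxE.
by rewrite big_split/= -!mulr_sumr b1 d1 !mulr1 addrCA subrr addr0.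
Qed.

Lemma econvex_E_phi_n (R : realType) (V W : Type) (n c : nat)
    (x : 'I_n -> V * W) (H : completeNormedModType R)
    (ev : {linear H -> (V * 'I_c -> R^o)}) (a : R) (phi : R -> R) (g : H) :
  econvex_on (@simplex_rows R n c) (fun gamma => E_phi_n x ev a phi gamma g).
Proof.
pose m : R := (n * (n - 1))%N%:R^-1.
pose A (gamma : 'M[R]_(n, c)) := m *
  \sum_(i < n) \sum_(j < n | i != j) \sum_(k < c) gamma i k * ev g ((x j).1, k).
pose C := `|g| ^+ 2 / (2 * a).
pose e (p : 'I_n * 'I_c) := conjugate phi (ev g ((x p.1).1, p.2)).
pose q : R := n%:R^-1.
pose S gamma := (\sum_p (gamma p.1 p.2)%:E * e p)%E.
have q0 : 0 <= q by rewrite invr_ge0.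
(* The possibly infinite sum [S] is isolated on the larger side, opposite a real number, so no
   subtraction of infinities remains. *)
have EE gamma (r : R) : (E_phi_n x ev a phi gamma g <= r%:E)%E =
    ((A gamma - (r - C))%:E <= q%:E * S gamma)%E.
  by rewrite /E_phi_n pair_bigA -leeBrDr// -EFinB leeBl_EFin.
have Acomb t b d : A (t *: b + (1 - t) *: d) = t * A b + (1 - t) * A d.
  rewrite /A !(mulrCA _ m) -mulrDr; congr (_ * _).
  rewrite !mulr_sumr -big_split; apply: eq_bigr => i _.
  rewrite !mulr_sumr -big_split; apply: eq_bigr => j _.
  rewrite !mulr_sumr -big_split; apply: eq_bigr => k _ /=.
  by rewrite !mxE mulrDl !mulrA.
apply: econvex_on_comb; first exact: convex_simplex_rows.
move=> t b d r s hb hd; rewrite !EE => hr hs.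
have t1 : 0 <= 1 - t%:num by rewrite subr_ge0.
have b0 (p : 'I_n * 'I_c) : 0 <= b p.1 p.2 by case: (hb p.1).
have d0 (p : 'I_n * 'I_c) : 0 <= d p.1 p.2 by case: (hd p.1).
have e0 p : e p != -oo%E by exact: conjugate_neq_ninfty.
(* An equality even when some [e p] is [+oo]: the scalars [q], [t] and [1 - t] are absorbed into the
   nonnegative weights, in which the sum is additive. *)
have -> : (q%:E * S (t%:num *: b + (1 - t%:num) *: d)%R =
    t%:num%:E * (q%:E * S b) + (1 - t%:num)%R%:E * (q%:E * S d))%E.
  rewrite !muleA -!EFinM -weighted_sume_comb ?mulr_ge0//.
  rewrite -weighted_sumeZ//; last first.
    by move=> p; rewrite !mxE addr_ge0// mulr_ge0.
  by apply: eq_bigr => p _; rewrite !mxE mulrDr !mulrA !(mulrC q).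
have -> : A (t%:num *: b + (1 - t%:num) *: d) -
      (t%:num * r + (1 - t%:num) * s - C) =
    t%:num * (A b - (r - C)) + (1 - t%:num) * (A d - (s - C)).
  by rewrite Acomb; ring.
by rewrite EFinD !EFinM; apply: leeD; apply: lee_wpmul2l; rewrite ?lee_fin.
Qed.

(** A maximum is bounded when each of its members is, which leaves finitely many real inequalities,
    affine in the scores and [gamma]; the empty maximum [-oo] matches the vacuous condition. *)
Lemma margin_constraint_le (R : realType) (V W : Type) (n c : nat)
    (x : 'I_n -> V * W) (theta : V * W -> 'I_c -> R^o) (gamma : 'M[R]_(n, c))
    (i : 'I_n) (j : 'I_c) (r : R) :
  (margin_constraint x theta gamma i j <= r%:E)%E <->
  forall k, k != j -> (theta (x i) k : R) - theta (x i) j + gamma i j <= r.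
Proof.
rewrite /margin_constraint -leeBrDr// leeBlDr// -EFinB -EFinD.
split=> [/bigmax_leP[_ h] k /h|h].
  by rewrite lee_fin => ?; lra.
apply/bigmax_leP; split=> [|k /h]; first exact: leNye.
by rewrite lee_fin => ?; lra.
Qed.

Lemma linear_score_comb (R : realType) (V W : Type) (c : nat)
    (H0 : completeNormedModType R) (dot0 : {dot H0 for idfun})
    (Phi : V * W -> 'I_c -> H0) (s t : R) (u v : H0) :
  linear_score dot0 Phi (s *: u + t *: v) =
  s *: linear_score dot0 Phi u + t *: linear_score dot0 Phi v.
Proof.
apply/funext => x; apply/funext => k.
by rewrite /linear_score linearDr !linearZr_LR.
Qed.

Theorem corollary1 (R : realType) (V W : Type) (n c : nat) (hn : (2 <= n)%N)
  (x : 'I_n -> V * W) (y : 'I_n -> 'I_c)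
  (H0 : completeNormedModType R) (dot0 : {dot H0 for idfun})
  (hH0 : hilbert_space dot0)
  (Phi : V * W -> 'I_c -> H0)
  (Theta : set (V * W -> 'I_c -> R^o))
  (hTheta : forall theta, Theta theta ->
     exists w : H0, theta = linear_score dot0 Phi w)
  (f : (V * W -> 'I_c -> R^o) -> V * W -> 'I_c)
  (hf : forall theta, Theta theta -> forall (x0 : V * W) (k : 'I_c),
     (theta x0 k : R) <= theta x0 (f theta x0))
  (F : set (V * W -> 'I_c))
  (hF : F = [set f theta | theta in Theta])
  (ell : 'I_c -> 'I_c -> ('I_c -> R) -> R)
  (hell : forall (x0 : V * W) (y0 : 'I_c),
     convex_on Theta (sample_loss f ell x0 y0))
  (H : completeNormedModType R) (dot : {dot H for idfun})
  (ev : {linear H -> (V * 'I_c -> R^o)})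
  (hH : is_rkhs dot ev)
  (G : set H)
  (a : R) (ha : 0 < a)
  (phi : R -> R)
  (hphi_convex : convex_on ([set u | 0 <= u] : set R^o) phi)
  (hphi_lsc : lower_semicontinuous (extend_pinfty phi))
  (hphi1 : phi 1 = 0)
  (eta : R) (heta : 0 <= eta) :
  convex_problem
    (fair_problem x y dot0 Phi Theta f F ell ev G a phi eta).
Proof.
set theta := linear_score dot0 Phi.
(* Convexity of [Theta] is part of [hell], but only at a given input and label; a sample provides
   both. *)
have i0 : 'I_n by exact: Ordinal (ltnW hn).
have [cTheta _] := hell (x i0) (y i0).
set P := fair_problem _ _ _ _ _ _ _ _ _ _ _ _ _.
have Dtheta z : ground P z -> Theta (theta z.1) by case.
have cD : convex_set (ground P).
  apply/convex_set_comb => t z1 z2 [T1 _ S1] [T2 _ S2].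
  set z := _ + _; have T : Theta (theta z.1).
    rewrite /theta linear_score_comb.
    by have /convex_set_comb := cTheta; apply.
  (* As [F] is the image of [Theta] under [f], the condition on [F] follows from the one on [Theta],
     and no convexity of [F] is involved. *)
  split=> //; first by rewrite hF; exists (theta z.1).
  by have /convex_set_comb := @convex_simplex_rows R n c; apply.
split; [split=> // | case=> [[i j]|[]]].
- apply: convex_function_scale; first by rewrite invr_ge0.
  apply: convex_function_sum => i t z1 z2 /set_mem/Dtheta T1 /set_mem/Dtheta T2.
  have [_ cell] := hell (x i) (y i).
  have := cell t _ _ (mem_set T1) (mem_set T2).
  rewrite [X in sample_loss _ _ _ _ X <= _](_ : _ = theta (conv t z1 z2).1)//.
  exact/esym/linear_score_comb.
- apply: econvex_on_comb => // t z1 z2 r s _ _.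
  move=> /margin_constraint_le h1 /margin_constraint_le h2.
  apply/margin_constraint_le => k kj.
  rewrite linear_score_comb !fctE !mxE.
  have t0 : 0 <= t%:num by [].
  have t1 : 0 <= 1 - t%:num by rewrite subr_ge0.
  have := lerD (ler_wpM2l t0 (h1 k kj)) (ler_wpM2l t1 (h2 k kj)).
  by rewrite /GRing.scale/=; lra.
- rewrite /=; apply: econvex_on_addr_cst; apply: econvex_on_ereal_sup => // g _.
  (* This constraint depends on [gamma] alone, so it is pulled back along the projection to the
     second variable. *)
  apply: (econvex_on_comp (L := snd)) (econvex_E_phi_n x ev a phi g) cD _.
  by move=> z [].
Qed.
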